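(* Let $\Lambda_0,\Lambda_1,\Lambda_2$ be three Lagrangians in $H(L)$. Choose two Lagrangian paths $\alpha_{01}$ and $\alpha_{12}$, where $\alpha_{ij}$ joins $\Lambda_i$ to $\Lambda_j$. Then the class in $W(k)$ of the symmetric bilinear form $$S(\alpha_{01} * \alpha_{12})\ \bot\ -S(\alpha_{01})\ \bot\ -S(\alpha_{12})$$ is independent of the choice of the paths $\alpha_{01}$ and $\alpha_{12}$.
   Context: $k$ is a field of characteristic different from $2$, $g\ge 1$, $L=k^g$, and $H(L)=L\oplus L^*$ carries the symplectic form $\omega((x,\xi),(y,\eta))=\xi(y)-\eta(x)$. A Lagrangian is a subspace $\Lambda\subset H(L)$ with $\Lambda=\Lambda^\perp$. Two Lagrangians are transverse, $\Lambda\pitchfork M$, if $\Lambda+M=H(L)$. For Lagrangians $\Lambda,M$ let $\beta_{\Lambda,M}:\Lambda\to M^*$, $\ell\mapsto \omega(\ell,-)|_M$; it is invertible iff $\Lambda\pitchfork M$. If $\Lambda,M$ are Lagrangians transverse to a Lagrangian $X$, then $d_X(\Lambda,M):X^*\to X$ is the symmetric linear map sending $\alpha$ to $m-\ell$, where $m\in M$, $\ell\in\Lambda$ are the unique elements with $\omega(m,-)|_X=\alpha=\omega(\ell,-)|_X$. A Lagrangian path joining $\Lambda_0$ to $\Lambda_{n+1}$ is a sequence of Lagrangians $\Lambda_0,\dots,\Lambda_{n+1}$ ($n\ge0$) with $\Lambda_i\pitchfork\Lambda_{i+1}$ for all $i$. Its Sylvester matrix $S(\Lambda_0,\dots,\Lambda_{n+1})$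 is the symmetric bilinear form with support $\Lambda_1^*\oplus\dots\oplus\Lambda_n^*$, viewed as a map $\Lambda_1^*\oplus\dots\oplus\Lambda_n^*\to\Lambda_1\oplus\dots\oplus\Lambda_n$, which is block tridiagonal with diagonal blocks $d_{\Lambda_i}(\Lambda_{i-1},\Lambda_{i+1})$, blocks $(\beta_{\Lambda_i,\Lambda_{i+1}})^{-1}$ in position $(i,i+1)$ and $-(\beta_{\Lambda_{i+1},\Lambda_i})^{-1}$ in position $(i+1,i)$. If a path $\alpha$ ends at $M$ and a path $\beta$ starts at $M$, the concatenation $\alpha*\beta$ is the juxtaposed sequence with $M$ written once. $W(k)$ is the Witt group of non-degenerate symmetric bilinear forms over $k$; the class in $W(k)$ of a possibly degenerate form $(P,q)$ is the class of its regularization, i.e. the induced form on $P/\ker q$. $\bot$ is orthogonal sum. *)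

(* Defs.v *)
From HB Require Import structures.
From mathcomp Require Import all_boot all_order all_algebra.

Set Implicit Arguments.
Unset Strict Implicit.
Unset Printing Implicit Defensive.

Import GRing.Theory VectorInternalTheory.
Local Open Scope ring_scope.

Definition dual (k : fieldType) (V : vectType k) : vectType k := 'Hom(V, k^o).

Lemma linear_lfunE (k : fieldType) (V W : vectType k) (f : V -> W) :
  linear f -> linfun f =1 f.
Proof.
move=> f_lin.
pose F : {linear V -> W} := HB.pack f (GRing.isLinear.Build k V W _ f f_lin).
exact: (lfunE F).
Qed.

Section MakeForms.
Variables (k : fieldType) (V : vectType k) (eps : bool) (f : V -> V -> k).
Hypothesis f_linear : forall v, linear (f^~ v : V -> k^o).
Hypothesis f_herm : forall u v, f u v = (-1) ^+ eps * f v u.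

Fact make_form_bilinear :
  bilinear_for (GRing.Scale.Law.clone _ _ *%R _)
               (GRing.Scale.Law.clone _ _ (idfun \; *%R) _) f.
Proof.
split=> [v|u] a x y /=; first exact: (f_linear v a x y).
rewrite f_herm (f_linear u a x y : f _ u = a * f x u + f y u).
by rewrite mulrDr mulrCA -!f_herm.
Qed.

Definition make_form : {hermitian V for eps & idfun} :=
  HB.pack f (bilinear_isBilinear.Build k V V k _ _ f make_form_bilinear)
            (isHermitianSesquilinear.Build k V eps idfun f f_herm).

End MakeForms.

Definition make_sym (k : fieldType) (V : vectType k) (f : V -> V -> k)
    (f_linear : forall v, linear (f^~ v : V -> k^o))
    (f_sym : forall u v, f u v = f v u) : {symmetric V} :=
  make_form (eps := false) f_linear
    (fun u v => etrans (f_sym u v) (esym (mul1r (f v u)))).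

Section QuotientSpace.
Variables (k : fieldType) (V : vectType k) (U : {vspace V}).

Definition vquot : Type := @Quotient.quot V U.
HB.instance Definition _ := GRing.Zmodule.on vquot.

Definition vquot_pi (x : V) : vquot := \pi_(@Quotient.quot V U)%qT x.
Definition vquot_repr (x : vquot) : V := repr (x : @Quotient.quot V U).

Lemma vquot_reprK : cancel vquot_repr vquot_pi.
Proof. exact: reprK. Qed.

Lemma vquot_piP x y : reflect (vquot_pi x = vquot_pi y) (x - y \in U).
Proof. by rewrite Quotient.idealrBE; apply: eqP. Qed.

Lemma vquot_piD : {morph vquot_pi : x y / x + y}.
Proof. by move=> x y; rewrite /vquot_pi -[RHS]Quotient.pi_add. Qed.

Definition vquot_scale (a : k) (x : vquot) := vquot_pi (a *: vquot_repr x).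

Lemma vquot_repr_pi x : vquot_repr (vquot_pi x) - x \in U.
Proof. by apply/vquot_piP; rewrite vquot_reprK. Qed.

Lemma vquot_piZ a x : vquot_pi (a *: x) = vquot_scale a (vquot_pi x).
Proof.
apply/esym/vquot_piP; rewrite -scalerBr.
by rewrite rpredZ // vquot_repr_pi.
Qed.

Fact vquot_scaleA a b x :
  vquot_scale a (vquot_scale b x) = vquot_scale (a * b) x.
Proof. by rewrite -[x]vquot_reprK -!vquot_piZ scalerA. Qed.
Fact vquot_scale1 : left_id 1 vquot_scale.
Proof. by move=> x; rewrite -[x]vquot_reprK -!vquot_piZ scale1r. Qed.
Fact vquot_scaleDr : right_distributive vquot_scale +%R.
Proof.
move=> a x y; rewrite -[x]vquot_reprK -[y]vquot_reprK.
by rewrite -!(vquot_piD, vquot_piZ) scalerDr.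
Qed.
Fact vquot_scaleDl x : {morph vquot_scale^~ x : a b / a + b}.
Proof.
by move=> a b; rewrite -[x]vquot_reprK -!(vquot_piD, vquot_piZ) scalerDl.
Qed.
HB.instance Definition _ := GRing.Zmodule_isLmodule.Build k vquot
  vquot_scaleA vquot_scale1 vquot_scaleDr vquot_scaleDl.

Fact vquot_pi_linear : linear vquot_pi.
Proof. by move=> a x y; rewrite vquot_piD vquot_piZ. Qed.
HB.instance Definition _ := GRing.isLinear.Build k V vquot *:%R vquot_pi
  vquot_pi_linear.

Let res (x : V) : subvs_of U^C := vsproj U^C (x - projv U x).

Let val_res x : vsval (res x) = x - projv U x.
Proof. by rewrite vsprojK ?memv_projC. Qed.

Let res_linear : linear res.
Proof.
by move=> a x y; rewrite /res -linearP; congr vsproj;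
  rewrite linearP/= scalerBr opprD addrACA.
Qed.

Let resP x y : reflect (res x = res y) (x - y \in U).
Proof.
have valB : vsval (res x) - vsval (res y) = (x - y) - projv U (x - y).
  by rewrite !val_res (linearB (projv U)) !opprD addrACA.
apply: (iffP idP) => [xyU|exy].
  by apply/val_inj/eqP; rewrite /= -subr_eq0 valB projv_id ?subrr.
have /eqP := valB; rewrite exy subrr eq_sym subr_eq0 => /eqP ->.
exact: memv_proj.
Qed.

Fact vquot_vect_iso : Vector.axiom (dim (subvs_of U^C)) vquot.
Proof.
exists (fun x => v2r (res (vquot_repr x))).
  move=> a x y; rewrite -linearP -res_linear; congr v2r; apply/resP.
  apply/vquot_piP.
  by rewrite vquot_piD vquot_piZ !vquot_reprK.
exists (fun w => vquot_pi (vsval (r2v w))) => [x|w].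
  rewrite v2rK -[RHS]vquot_reprK; apply/vquot_piP; rewrite val_res.
  by rewrite addrAC subrr add0r rpredN memv_proj.
rewrite -[RHS]r2vK; congr v2r; transitivity (res (vsval (r2v w))).
  exact/resP/vquot_repr_pi.
apply: val_inj; rewrite /= val_res.
have /eqP -> : projv U (vsval (r2v w)) == 0.
  by rewrite -memv_ker lker_proj subvsP.
by rewrite subr0.
Qed.
HB.instance Definition _ :=
  Lmodule_hasFinDim.Build k vquot vquot_vect_iso.

End QuotientSpace.

Section DirectSum.
Variables (k : fieldType) (I : finType) (V : I -> vectType k).

Definition dsum : Type := {dffun forall i : I, V i}.
HB.instance Definition _ := Choice.on dsum.

Definition dsum_of (x : forall i, V i) : dsum := finfun x.
Definition dsum_at (x : dsum) (i : I) : V i := x i.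

Lemma dsum_ofE x i : dsum_at (dsum_of x) i = x i.
Proof. exact: ffunE. Qed.

Lemma dsumP x y : (forall i, dsum_at x i = dsum_at y i) <-> x = y.
Proof. exact: ffunP. Qed.

Definition dsum_zero := dsum_of (fun i => 0).
Definition dsum_opp x := dsum_of (fun i => - dsum_at x i).
Definition dsum_add x y := dsum_of (fun i => dsum_at x i + dsum_at y i).
Definition dsum_scale (a : k) x := dsum_of (fun i => a *: dsum_at x i).

Fact dsum_addA : associative dsum_add.
Proof. by move=> x y z; apply/dsumP=> i; rewrite !dsum_ofE addrA. Qed.
Fact dsum_addC : commutative dsum_add.
Proof. by move=> x y; apply/dsumP=> i; rewrite !dsum_ofE addrC. Qed.
Fact dsum_add0 : left_id dsum_zero dsum_add.
Proof. by move=> x; apply/dsumP=> i; rewrite !dsum_ofE add0r. Qed.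
Fact dsum_addN : left_inverse dsum_zero dsum_opp dsum_add.
Proof. by move=> x; apply/dsumP=> i; rewrite !dsum_ofE addNr. Qed.
HB.instance Definition _ := GRing.isZmodule.Build dsum
  dsum_addA dsum_addC dsum_add0 dsum_addN.

Fact dsum_scaleA a b x : dsum_scale a (dsum_scale b x) = dsum_scale (a * b) x.
Proof. by apply/dsumP=> i; rewrite !dsum_ofE scalerA. Qed.
Fact dsum_scale1 : left_id 1 dsum_scale.
Proof. by move=> x; apply/dsumP=> i; rewrite !dsum_ofE scale1r. Qed.
Fact dsum_scaleDr : right_distributive dsum_scale +%R.
Proof. by move=> a x y; apply/dsumP=> i; rewrite !dsum_ofE scalerDr. Qed.
Fact dsum_scaleDl x : {morph dsum_scale^~ x : a b / a + b}.
Proof. by move=> a b; apply/dsumP=> i; rewrite !dsum_ofE scalerDl. Qed.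
HB.instance Definition _ := GRing.Zmodule_isLmodule.Build k dsum
  dsum_scaleA dsum_scale1 dsum_scaleDr dsum_scaleDl.

Lemma dsum_atP a x y i :
  dsum_at (a *: x + y) i = a *: dsum_at x i + dsum_at y i.
Proof. by rewrite !dsum_ofE. Qed.

Fact dsum_vect_iso :
  Vector.axiom #|{: {i : I & 'I_(dim (V i))}}| dsum.
Proof.
exists (fun x => \row_j
  let u := enum_val j in v2r (dsum_at x (tag u)) 0 (tagged u)).
  by move=> a x y; apply/rowP=> j; rewrite !mxE /= dsum_atP linearP !mxE.
exists (fun w : 'rV_#|{: {i : I & 'I_(dim (V i))}}| => dsum_of (fun i =>
  r2v (\row_(j < dim (V i)) w 0 (enum_rank (Tagged (fun i => 'I_(dim (V i))) j))))).
  move=> x; apply/dsumP=> i; rewrite /= dsum_ofE -[RHS]v2rK; congr r2v.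
  by apply/rowP=> j; rewrite !mxE enum_rankK.
move=> w; apply/rowP=> j; rewrite mxE /= dsum_ofE r2vK mxE.
by congr (w 0 _); rewrite -[RHS]enum_valK; congr enum_rank; case: (enum_val j).
Qed.
HB.instance Definition _ := Lmodule_hasFinDim.Build k dsum dsum_vect_iso.

End DirectSum.

Record sym_form (k : fieldType) := SymForm {
  form_support : vectType k;
  sym_form_val :> {symmetric form_support}
}.

Section WittClasses.
Variable k : fieldType.
Implicit Types q r s m n : sym_form k.

Definition isometric q r : Prop :=
  exists2 f : 'Hom(form_support q, form_support r), bijective f & isometry r q f.

Section OrthogonalSum.
Variables q r : sym_form k.

Definition osum_val (u v : form_support q * form_support r) : k :=
  q u.1 v.1 + r u.2 v.2.

Fact osum_linear v : linear (osum_val^~ v : _ -> k^o).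
Proof.
move=> a x y; rewrite /osum_val /= !linearDl !linearZl_LR /=.
by rewrite scalerDr addrACA.
Qed.

Fact osum_sym u v : osum_val u v = osum_val v u.
Proof.
by rewrite /osum_val (hermC q) (hermC r) !expr0 !mul1r.
Qed.

Definition osum : sym_form k :=
  SymForm (make_sym osum_linear osum_sym).

End OrthogonalSum.

Section Opposite.
Variable q : sym_form k.

Definition oform_val (u v : form_support q) : k := - q u v.

Fact oform_linear v : linear (oform_val^~ v : _ -> k^o).
Proof.
move=> a x y; rewrite /oform_val linearDl linearZl_LR opprD.
by rewrite scalerN.
Qed.

Fact oform_sym u v : oform_val u v = oform_val v u.
Proof. by rewrite /oform_val (hermC q) expr0 mul1r. Qed.

Definition oform : sym_form k :=
  SymForm (make_sym oform_linear oform_sym).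

End Opposite.

Section Regularization.
Variable q : sym_form k.

(* [orthov q fullv] is the kernel of q, so this is the form induced by q on
   P / ker q; [reg_valE] shows that it does not depend on representatives. *)
Definition reg_val (u v : vquot (orthov q fullv)) : k :=
  q (vquot_repr u) (vquot_repr v).

Lemma reg_valE x y :
  reg_val (vquot_pi (orthov q fullv) x) (vquot_pi (orthov q fullv) y) = q x y.
Proof.
have radl u v w : u - v \in orthov q fullv -> q u w = q v w.
  move/mem_orthovP/(_ w (memvf w))/eqP.
  by rewrite linearBl subr_eq0 => /eqP.
rewrite /reg_val (radl _ x) ?vquot_repr_pi //.
by rewrite [LHS]hermC [RHS]hermC (radl _ y x) ?vquot_repr_pi //.
Qed.

Fact reg_linear v : linear (reg_val^~ v : _ -> k^o).
Proof.
move=> a x y; rewrite -[x]vquot_reprK -[y]vquot_reprK -[v]vquot_reprK.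
by rewrite -linearP !reg_valE linearDl linearZl_LR.
Qed.

Fact reg_sym u v : reg_val u v = reg_val v u.
Proof. by rewrite /reg_val (hermC q) expr0 mul1r. Qed.

Definition regularization : sym_form k :=
  SymForm (make_sym reg_linear reg_sym).

Lemma regularization_nondegenerate : nondegenerate regularization.
Proof.
rewrite /nondegenerate -subv0; apply/subvP => u /mem_orthovP u_rad.
rewrite memv0 -[u]vquot_reprK -[0](linear0 (vquot_pi (orthov q fullv))).
apply/eqP/vquot_piP; rewrite subr0; apply/mem_orthovP => x _.
rewrite -reg_valE vquot_reprK; apply: u_rad; exact: memvf.
Qed.

End Regularization.

Definition metabolic q : Prop :=
  nondegenerate q /\ exists N : {vspace form_support q}, N = orthov q N.

(* W(k) is the monoid of isometry classes of nondegenerate forms under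
   orthogonal sum, modulo the metabolic ones: two nondegenerate forms have the
   same class iff they become isometric after adding metabolic forms. *)
Definition witt_equiv q r : Prop :=
  exists m n, [/\ metabolic m, metabolic n & isometric (osum q m) (osum r n)].

Lemma isometric_refl q : isometric q q.
Proof.
exists \1%VF; first by exists id => x; rewrite id_lfunE.
by move=> u v; rewrite !id_lfunE.
Qed.

Lemma isometric_sym q r : isometric q r -> isometric r q.
Proof.
case=> f f_bij f_iso; exists f^-1%VF.
  have fK := lker0_lfunK (introT lker0P (bij_inj f_bij)).
  by exists f => // x; apply: (bij_inj (bij_can_bij f_bij fK)); rewrite fK.
have [h hK Kh] := f_bij.
have fK := lker0_lfunK (introT lker0P (bij_inj f_bij)).
by move=> u v; rewrite -{2}[u]Kh -{2}[v]Kh f_iso -[u in LHS]Kh -[v in LHS]Kh !fK.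
Qed.

Lemma isometric_trans r q s :
  isometric q r -> isometric r s -> isometric q s.
Proof.
case=> f f_bij f_iso [h h_bij h_iso]; exists (h \o f)%VF.
  by apply: (@eq_bij _ _ (h \o f)) => [|x]; [exact: bij_comp | rewrite lfunE].
by move=> u v; rewrite !lfunE /= h_iso f_iso.
Qed.

Lemma isometricI q r (f : form_support q -> form_support r) :
  linear f -> bijective f -> (forall u v, r (f u) (f v) = q u v) ->
  isometric q r.
Proof.
move=> f_lin f_bij f_iso; exists (linfun f).
  by apply: (@eq_bij _ _ f) => // x; rewrite linear_lfunE.
by move=> u v; rewrite !linear_lfunE.
Qed.

Lemma osumE q r u v : osum q r u v = q u.1 v.1 + r u.2 v.2.
Proof. by []. Qed.

Lemma isometric_osum q q' r r' :
  isometric q q' -> isometric r r' -> isometric (osum q r) (osum q' r').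
Proof.
case=> f [f' fK Kf] f_iso [h [h' hK Kh] h_iso].
apply: (@isometricI (osum q r) (osum q' r') (fun u => (f u.1, h u.2))).
- by move=> a x y; rewrite /= !linearP.
- by exists (fun u => (f' u.1, h' u.2)) => -[x y] /=; rewrite ?fK ?hK ?Kf ?Kh.
- by move=> u v; rewrite !osumE f_iso h_iso.
Qed.

Lemma osumA q r s : isometric (osum q (osum r s)) (osum (osum q r) s).
Proof.
apply: (@isometricI (osum q (osum r s)) (osum (osum q r) s)
  (fun u => ((u.1, u.2.1), u.2.2))) => //.
- by exists (fun u => (u.1.1, (u.1.2, u.2))) => [[x [y z]]|[[x y] z]].
- by move=> u v; rewrite !osumE addrA.
Qed.

Lemma osumC q r : isometric (osum q r) (osum r q).
Proof.
apply: (@isometricI (osum q r) (osum r q) (fun u => (u.2, u.1))) => //.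
- by exists (fun u => (u.2, u.1)); case.
- by move=> u v; rewrite !osumE addrC.
Qed.

Lemma metabolic_osum q r : metabolic q -> metabolic r -> metabolic (osum q r).
Proof.
case=> /eqP q_nd [M eM] [/eqP r_nd [N eN]].
have q0 u : (forall v, q u v = 0) -> u = 0.
  move=> u0; apply/eqP; rewrite -memv0 -q_nd; apply/mem_orthovP=> v _; exact: u0.
have r0 u : (forall v, r u v = 0) -> u = 0.
  move=> u0; apply/eqP; rewrite -memv0 -r_nd; apply/mem_orthovP=> v _; exact: u0.
split.
  rewrite /nondegenerate -subv0; apply/subvP=> -[x y] /mem_orthovP u0.
  rewrite memv0; apply/eqP; congr (_, _).
    by apply: q0 => v; have := u0 (v, 0) (memvf _);
       rewrite osumE /= linear0r addr0.
  by apply: r0 => v; have := u0 (0, v) (memvf _);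
     rewrite osumE /= linear0r add0r.
pose h (u : form_support (osum q r)) : form_support (osum q r) :=
  (u.1 - projv M u.1, u.2 - projv N u.2).
have h_lin : linear h.
  move=> a x y; rewrite /h /= !linearP.
  by congr (_, _); rewrite /= addrACA -scalerDr.
exists (lker (linfun h)).
have projE (V : vectType k) (W : {vspace V}) x : (x - projv W x == 0) = (x \in W).
  by rewrite subr_eq0; apply/eqP/idP => [->|xW]; rewrite ?memv_proj ?projv_id.
have memE u : (u \in lker (linfun h)) = (u.1 \in M) && (u.2 \in N).
  by rewrite memv_ker linear_lfunE // -!projE; case: u => x y.
apply/vspaceP=> u; apply/idP/mem_orthovP => [|u0].
  rewrite memE => /andP[uM uN] v; rewrite memE => /andP[vM vN].
  move: uM uN; rewrite eM eN => /mem_orthovP uM /mem_orthovP uN.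
  by rewrite osumE uM ?uN ?addr0.
rewrite memE eM eN; apply/andP; split; apply/mem_orthovP => v vM.
  have := u0 (v, 0); rewrite memE osumE /= vM mem0v linear0r addr0.
  exact.
have := u0 (0, v); rewrite memE osumE /= vM mem0v linear0r add0r.
exact.
Qed.

Lemma witt_equiv_refl q : witt_equiv q q.
Proof.
have lin0 (v : 'rV[k]_0) : linear ((fun _ _ => 0)^~ v : 'rV[k]_0 -> k^o).
  by move=> a x y; rewrite scaler0 addr0.
pose z := SymForm (make_sym lin0 (fun _ _ => erefl)).
have all0 (U W : {vspace form_support z}) : U = W.
  by apply/vspaceP=> x; rewrite [x]thinmx0 !mem0v.
have mz : metabolic z.
  by split; [apply/eqP/all0 | exists 0%VS; apply: all0].
by exists z, z; split=> //; apply: isometric_refl.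
Qed.

Lemma witt_equiv_sym q r : witt_equiv q r -> witt_equiv r q.
Proof. by case=> m [n [mm mn /isometric_sym qr]]; exists n, m. Qed.

Lemma witt_equiv_trans r q s :
  witt_equiv q r -> witt_equiv r s -> witt_equiv q s.
Proof.
case=> m [n [mm mn qr]] [m' [n' [mm' mn' rs]]].
exists (osum m m'), (osum n' n); split; try exact: metabolic_osum.
apply: isometric_trans (osumA _ _ _) _.
apply: isometric_trans (isometric_osum qr (isometric_refl m')) _.
apply: isometric_trans (isometric_sym (osumA _ _ _)) _.
apply: isometric_trans
  (isometric_osum (isometric_refl r) (osumC n m')) _.
apply: isometric_trans (osumA _ _ _) _.
apply: isometric_trans (isometric_osum rs (isometric_refl n)) _.
exact: isometric_sym (osumA _ _ _).
Qed.

Definition same_witt_class q r : Prop :=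
  witt_equiv (regularization q) (regularization r).

End WittClasses.

Section Hyperbolic.
Variables (k : fieldType) (g : nat).

Definition hyp : vectType k := ('rV[k]_g * dual 'rV[k]_g)%type.

Definition omega_val (u v : hyp) : k := u.2 v.1 - v.2 u.1.

Fact omega_linear v : linear (omega_val^~ v : hyp -> k^o).
Proof.
move=> a x y; rewrite /omega_val /= linearP add_lfunE scale_lfunE.
by rewrite opprD addrACA scalerBr.
Qed.

Fact omega_skew u v : omega_val u v = (-1) ^+ true * omega_val v u.
Proof. by rewrite /omega_val expr1 mulN1r opprB. Qed.

Definition omega : {skew_symmetric hyp} := make_form omega_linear omega_skew.

Lemma omegaE u v : omega u v = u.2 v.1 - v.2 u.1.
Proof. by []. Qed.

Lemma omegaDr u v w : omega u (v + w) = omega u v + omega u w.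
Proof. exact: linearDr. Qed.

Lemma omegaBr u v w : omega u (v - w) = omega u v - omega u w.
Proof. exact: linearBr. Qed.

Lemma omegaBl u v w : omega (u - v) w = omega u w - omega v w.
Proof. exact: linearBl. Qed.

Lemma omegaC u v : omega u v = - omega v u.
Proof. by rewrite [LHS]hermC expr1 mulN1r. Qed.

Definition lagrangian (X : {vspace hyp}) : bool := X == orthov omega X.

Definition transverse (X Y : {vspace hyp}) : bool := (X + Y == fullv)%VS.

Definition beta_val (X Y : {vspace hyp}) (l : subvs_of X) (m : subvs_of Y) :
  k^o := omega (vsval l) (vsval m).

Definition beta (X Y : {vspace hyp}) :
    'Hom(subvs_of X, dual (subvs_of Y)) :=
  linfun (fun l => linfun (beta_val l) : dual (subvs_of Y)).

Lemma betaE X Y l m : beta X Y l m = omega (vsval l) (vsval m).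
Proof.
have lin2 l' : linear (@beta_val X Y l').
  by move=> a u v; rewrite /beta_val linearP.
rewrite /beta linear_lfunE ?linear_lfunE // => a u v.
apply/lfunP=> w; rewrite add_lfunE scale_lfunE !linear_lfunE //.
by rewrite /beta_val linearDl linearZl_LR.
Qed.

Lemma omega_nondegenerate u : (forall v, omega u v = 0) -> u = 0.
Proof.
case: u => x xi u0; congr (_, _).
  apply/rowP=> j; rewrite mxE.
  pose e (v : 'rV[k]_g) : k^o := v 0 j.
  have e_lin : linear e by move=> a v w; rewrite /e !mxE.
  have := u0 (0, linfun e).
  by rewrite omegaE /= linear0 linear_lfunE // sub0r => /eqP; rewrite oppr_eq0 => /eqP.
apply/lfunP=> y; have := u0 (y, 0).
by rewrite omegaE /= zero_lfunE subr0 => ->; rewrite zero_lfunE.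
Qed.

Lemma lagrangian_mem X u : lagrangian X ->
  reflect (forall v, v \in X -> omega u v = 0) (u \in X).
Proof. by move=> /eqP e; rewrite [in u \in X]e; apply: mem_orthovP. Qed.

Section Transverse.
Variables X Y : {vspace hyp}.
Hypotheses (lagX : lagrangian X) (lagY : lagrangian Y).
Hypothesis XY : transverse X Y.

Lemma beta_ker : lker (beta X Y) = 0%VS.
Proof.
apply/eqP; rewrite -subv0; apply/subvP=> l; rewrite memv_ker memv0 => /eqP l0.
apply/eqP/val_inj/omega_nondegenerate => v.
have /memv_addP[x xX [y yY ->]] : v \in (X + Y)%VS by rewrite (eqP XY) memvf.
rewrite omegaDr (elimT (lagrangian_mem _ lagX) (subvsP l)) //.
rewrite add0r -[y](vsprojK yY) -betaE l0 zero_lfunE //.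
Qed.

End Transverse.

Lemma transverseC X Y : transverse X Y = transverse Y X.
Proof. by rewrite /transverse addvC. Qed.

Lemma beta_invK X Y : lagrangian X -> lagrangian Y -> transverse X Y ->
  cancel (beta X Y)^-1%VF (beta X Y).
Proof.
move=> lX lY tXY.
have dimle A B : lagrangian A -> lagrangian B -> transverse A B ->
    (\dim A <= \dim B)%N /\ \dim (limg (beta A B)) = \dim A.
  move=> lA lB tAB; have := limg_ker_dim (beta A B) fullv.
  rewrite beta_ker // capv0 dimv0 add0n => e; split.
    have := dimvS (subvf (limg (beta A B))).
    by rewrite e !dimvf /dim /= muln1.
  by rewrite e dimvf.
have [leXY eXY] := dimle X Y lX lY tXY.
have [leYX _] := dimle Y X lY lX (etrans (transverseC Y X) tXY).
have full : limg (beta X Y) = fullv.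
  apply/eqP; rewrite eqEdim subvf eXY dimvf /dim /= muln1 //.
by move=> a; apply: limg_lfunVK; rewrite full memvf.
Qed.

(* By [beta_invK], (beta B X)^-1 a is the unique m in B with
   omega(m, -)|_X = a, and likewise for A.  The difference of the two elements
   lies in X^perp = X, so [vsproj] only records that membership ([dmapE]). *)
Definition dmap (X A B : {vspace hyp}) :
    'Hom(dual (subvs_of X), subvs_of X) :=
  linfun (fun a =>
    vsproj X (vsval ((beta B X)^-1%VF a) - vsval ((beta A X)^-1%VF a))).

Lemma dmapE X A B a : lagrangian X -> lagrangian A -> lagrangian B ->
    transverse A X -> transverse B X ->
  vsval (dmap X A B a) =
  vsval ((beta B X)^-1%VF a) - vsval ((beta A X)^-1%VF a).
Proof.
move=> lX lA lB tA tB; rewrite /dmap.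
set f := (f in linfun f).
have f_lin : linear f.
  move=> c u v; rewrite /f -linearP; congr vsproj.
  by rewrite !linearP /= addrACA -scalerDr.
rewrite linear_lfunE // vsprojK //; apply/(lagrangian_mem _ lX) => x xX.
rewrite omegaBl -[x](vsprojK xX).
by rewrite -!betaE !beta_invK // subrr.
Qed.

Lemma lagrangian_isotropic X u v :
  lagrangian X -> u \in X -> v \in X -> omega u v = 0.
Proof. by move=> lX /(lagrangian_mem _ lX); apply. Qed.

Lemma beta_inv_adjoint X Y (a : dual (subvs_of Y)) (c : dual (subvs_of X)) :
  lagrangian X -> lagrangian Y -> transverse X Y ->
  c ((beta X Y)^-1%VF a) = - a ((beta Y X)^-1%VF c).
Proof.
move=> lX lY tXY.
have eY := beta_invK lX lY tXY a.
have eX := beta_invK lY lX (etrans (transverseC Y X) tXY) c.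
by rewrite -{1}eX -{2}eY !betaE omegaC.
Qed.

Lemma dmap_sym X A B (a c : dual (subvs_of X)) :
  lagrangian X -> lagrangian A -> lagrangian B ->
  transverse A X -> transverse B X ->
  c (dmap X A B a) = a (dmap X A B c).
Proof.
move=> lX lA lB tA tB.
rewrite -{1}(beta_invK lB lX tB c) -{2}(beta_invK lA lX tA a) !betaE !dmapE //.
rewrite !omegaBr.
rewrite [omega _ (vsval ((beta B X)^-1%VF a))](lagrangian_isotropic lB)
  ?subvsP //.
rewrite [X in _ = _ - X](lagrangian_isotropic lA) ?subvsP //.
by rewrite sub0r subr0 [RHS]omegaC.
Qed.

(* A path X_0, ..., X_(n+1) is stored as a sequence of length n + 2 >= 2. *)
Record lag_path (X Y : {vspace hyp}) := LagPath {
  path_seq :> seq {vspace hyp};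
  path_size : (1 < size path_seq)%N;
  path_lagrangian : all lagrangian path_seq;
  path_transverse : sorted transverse path_seq;
  path_head : head 0%VS path_seq = X;
  path_last : last 0%VS path_seq = Y
}.

Section Concatenation.
Variables (X Y Z : {vspace hyp}) (a : lag_path X Y) (b : lag_path Y Z).

Definition concat_seq : seq {vspace hyp} := a ++ behead b.

Fact concat_size : (1 < size concat_seq)%N.
Proof. by rewrite size_cat ltn_addr // path_size. Qed.

Fact concat_lagrangian : all lagrangian concat_seq.
Proof.
rewrite all_cat path_lagrangian /=; apply/allP=> U /mem_behead Ub.
exact: (allP (path_lagrangian b)).
Qed.

Fact concat_transverse : sorted transverse concat_seq.
Proof.
have := path_transverse a; have := path_transverse b.
have := path_last a; have := path_head b.
have := path_size a; have := path_size b; rewrite /concat_seq.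
case: (path_seq a) => [//|x s]; case: (path_seq b) => [//|y t] /= _ _ -> eY.
by rewrite cat_path eY => -> ->.
Qed.

Fact concat_head : head 0%VS concat_seq = X.
Proof.
have := path_head a; have := path_size a; rewrite /concat_seq.
by case: (path_seq a).
Qed.

Fact concat_last : last 0%VS concat_seq = Z.
Proof.
have := path_last a; have := path_head b; have := path_last b.
have := path_size b; rewrite /concat_seq last_cat.
by case: (path_seq b) => [//|y t] /= _ <- -> ->.
Qed.

Definition path_concat : lag_path X Z :=
  LagPath concat_size concat_lagrangian concat_transverse
          concat_head concat_last.

End Concatenation.

Section Sylvester.
Variable s : seq {vspace hyp}.

Definition syl_size : nat := (size s - 2)%N.

Definition path_at (i : nat) : {vspace hyp} := nth 0%VS s i.

(* The index i : 'I_n stands for the interior Lagrangian X_(i+1) of the path,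
   whose neighbours are X_i and X_(i+2). *)
Definition syl_lag (i : 'I_syl_size) : {vspace hyp} := path_at i.+1.

Definition syl_support : vectType k :=
  dsum (fun i => dual (subvs_of (syl_lag i))).

Definition syl_target : vectType k := dsum (fun i => subvs_of (syl_lag i)).

(* Row i of the block tridiagonal matrix applied to x; the subdiagonal blocks,
   where j = i - 1, carry the sign -1. *)
Definition syl_map (x : syl_support) : syl_target :=
  dsum_of (fun i : 'I_syl_size =>
      dmap (syl_lag i) (path_at i) (path_at i.+2) (dsum_at x i)
    + \sum_(j < syl_size | j == i.+1 :> nat)
        (beta (syl_lag i) (syl_lag j))^-1%VF (dsum_at x j)
    - \sum_(j < syl_size | i == j.+1 :> nat)
        (beta (syl_lag i) (syl_lag j))^-1%VF (dsum_at x j)).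

Lemma syl_mapE x i : dsum_at (syl_map x) i =
      dmap (syl_lag i) (path_at i) (path_at i.+2) (dsum_at x i)
    + \sum_(j < syl_size | j == i.+1 :> nat)
        (beta (syl_lag i) (syl_lag j))^-1%VF (dsum_at x j)
    - \sum_(j < syl_size | i == j.+1 :> nat)
        (beta (syl_lag i) (syl_lag j))^-1%VF (dsum_at x j).
Proof. exact: dsum_ofE. Qed.

(* The bilinear form of S : P -> P^*, where the target (+)_i X_i is identified
   with the dual of P = (+)_i X_i^* by evaluation. *)
Definition syl_val (x y : syl_support) : k :=
  \sum_i dsum_at y i (dsum_at (syl_map x) i).

End Sylvester.

Lemma syl_map_linear s : linear (@syl_map s).
Proof.
move=> a u v; apply/dsumP=> i; rewrite dsum_atP !syl_mapE.
rewrite dsum_atP linearP scalerBr scalerDr !scaler_sumr.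
rewrite addrACA -opprD [in RHS]addrACA -!big_split /=.
congr (_ + _ - _); apply: eq_bigr => j _; rewrite dsum_atP;
  exact: linearP.
Qed.

Fact syl_linear s y : linear ((@syl_val s)^~ y : syl_support s -> k^o).
Proof.
move=> a u v; rewrite /syl_val scaler_sumr -big_split; apply: eq_bigr => i _.
by rewrite syl_map_linear dsum_atP linearP.
Qed.

Section SylvesterForm.
Variables (X Y : {vspace hyp}) (p : lag_path X Y).

Let lag_lagrangian i : (i < size p)%N -> lagrangian (path_at p i).
Proof. by move=> ip; apply: (allP (path_lagrangian p)); apply: mem_nth. Qed.

Let lag_transverse i : (i.+1 < size p)%N ->
  transverse (path_at p i) (path_at p i.+1).
Proof.
have := path_transverse p; rewrite /path_at.
case: (path_seq p) => // x t /= /(pathP 0%VS) tr it.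
exact: tr.
Qed.

Let syl_size_bound (i : 'I_(syl_size p)) : (i.+2 < size p)%N.
Proof. by have := ltn_ord i; rewrite /syl_size ltn_subRL add2n. Qed.

Let adjoint (i j : 'I_(syl_size p)) a c : j = i.+1 :> nat ->
  (c : dual _) ((beta (syl_lag i) (syl_lag j))^-1%VF a) =
  - (a : dual _) ((beta (syl_lag j) (syl_lag i))^-1%VF c).
Proof.
move=> ji; apply: beta_inv_adjoint; rewrite /syl_lag.
- by apply: lag_lagrangian; exact: ltnW (syl_size_bound i).
- by apply: lag_lagrangian; exact: ltnW (syl_size_bound j).
- by rewrite ji; apply: lag_transverse; exact: syl_size_bound.
Qed.

Fact syl_sym u v : @syl_val p u v = @syl_val p v u.
Proof.
have syl_valE x y : @syl_val p x y =
    \sum_i dsum_at y i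
       (dmap (syl_lag i) (path_at p i) (path_at p i.+2) (dsum_at x i))
  + \sum_(i < syl_size p) \sum_(j < syl_size p | j == i.+1 :> nat)
      dsum_at y i ((beta (syl_lag i) (syl_lag j))^-1%VF (dsum_at x j))
  - \sum_(i < syl_size p) \sum_(j < syl_size p | i == j.+1 :> nat)
      dsum_at y i ((beta (syl_lag i) (syl_lag j))^-1%VF (dsum_at x j)).
  rewrite /syl_val -big_split -sumrB /=; apply: eq_bigr => i _.
  by rewrite syl_mapE linearB linearD /= !linear_sum.
have swap (x y : syl_support p) :
    \sum_(i < syl_size p) \sum_(j < syl_size p | i == j.+1 :> nat)
      dsum_at y i ((beta (syl_lag i) (syl_lag j))^-1%VF (dsum_at x j)) =
  - \sum_(i < syl_size p) \sum_(j < syl_size p | j == i.+1 :> nat)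
      dsum_at x i ((beta (syl_lag i) (syl_lag j))^-1%VF (dsum_at y j)).
  rewrite (exchange_big_dep predT) //= -sumrN; apply: eq_bigr => j _.
  rewrite -sumrN; apply: eq_bigr => i /eqP ij.
  by rewrite [in RHS](adjoint _ _ ij) opprK.
rewrite !syl_valE (swap u v) (swap v u) !opprK -!addrA; congr (_ + _).
  apply: eq_bigr => i _; have ib := syl_size_bound i.
  have ib' := ltnW ib; have ib'' := ltnW ib'.
  apply: dmap_sym; try exact: lag_lagrangian; first exact: lag_transverse.
  by rewrite transverseC; apply: lag_transverse.
by rewrite addrC.
Qed.

Definition sylvester : sym_form k :=
  SymForm (make_sym (@syl_linear p) syl_sym).

End SylvesterForm.

End Hyperbolic.

(* Main.v *)
Require Import Defs.
From mathcomp Require Import all_boot all_order all_algebra ring.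
Set Implicit Arguments.
Unset Strict Implicit.
Unset Printing Implicit Defensive.
Import GRing.Theory.
Local Open Scope ring_scope.

(** The Witt class in question is that of a form built from L0, L1, L2 alone,
    hence the paths do not matter.

    Area forms.  For a sequence s of Lagrangians X_0, ..., X_N consider the
    closed polygons with vertices P_0 = 0, P_1, ..., P_N, P_(N+1) = 0 in the
    symplectic space whose i-th side P_(i+1) - P_i lies in X_i.  They form a
    vector space with the symmetric form
      area(P, Q) = sum_i omega(P_i, Q_(i+1) - Q_i),
    which at P = Q is twice the symplectic area enclosed by P.  For a path p of
    consecutively transverse Lagrangians, the area form is isometric to the
    Sylvester form of p ([area_form_sylvester]): restricting omega(P_i, -) to
    X_i, for the interior i, gives a point of the sum of the X_i^*, the vertices
    are recovered from these restrictions by transversality, and row i of the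
    Sylvester matrix computes the i-th side.

    Gluing.  Let a go from L0 to L1 and b from L1 to L2.  A polygon along the
    concatenation of a and b can be glued from a polygon along a, one along b
    and one on the triangle (L0, L1, L2), by adding vertices, and the
    areas add up, without cross terms ([area_glue_glue]).  Gluing need be neither
    injective nor surjective, but every polygon orthogonal to all glued ones is
    itself glued ([glue_polar]).  So the graph of gluing is isotropic for
      area(a * b) - area(a) - area(b) - area(L0, L1, L2),
    and is its own orthogonal up to the radical.

    Witt classes.  Such a graph becomes a Lagrangian of the regularized
    difference of two forms, which is therefore metabolic, and the two forms
    have the same Witt class ([witt_correspondence]).  The class of
    S(a * b) - S(a) - S(b) is thus that of area(L0, L1, L2). *)

(** * Forms with the same Witt class *)

Section WittCorrespondence.
Variable k : fieldType.
Implicit Types q r : sym_form k.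

Lemma nondegenerateP q :
  reflect (forall x, (forall y, q x y = 0) -> x = 0) (nondegenerate q).
Proof.
rewrite /nondegenerate -subv0.
apply: (iffP subvP) => [q0 x x0|q0 x /mem_orthovP x0].
  by apply/eqP; rewrite -memv0; apply: q0; apply/mem_orthovP => y _; apply: x0.
by rewrite memv0; apply/eqP/q0 => y; apply: x0; apply: memvf.
Qed.

Lemma nondegenerate_osum q r :
  nondegenerate q -> nondegenerate r -> nondegenerate (osum q r).
Proof.
move=> /nondegenerateP q0 /nondegenerateP r0.
apply/nondegenerateP => -[x y] xy0; congr (_, _).
  by apply: q0 => v; have := xy0 (v, 0); rewrite osumE /= linear0r addr0.
by apply: r0 => v; have := xy0 (0, v); rewrite osumE /= linear0r add0r.
Qed.

Lemma nondegenerate_oform q : nondegenerate q -> nondegenerate (oform q).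
Proof.
move=> /nondegenerateP q0; apply/nondegenerateP => x x0; apply: q0 => y.
by apply/eqP; rewrite -oppr_eq0; apply/eqP/(x0 y).
Qed.

Lemma osum_oformE q r x y : osum q (oform r) x y = q x.1 y.1 - r x.2 y.2.
Proof. by []. Qed.

Lemma regularizationE q x y :
  regularization q (vquot_pi (orthov q fullv) x) (vquot_pi (orthov q fullv) y)
  = q x y.
Proof. exact: reg_valE. Qed.

(** The graph {(f z, h z)} is isotropic in q - r, and the last hypothesis says
    that its orthogonal exceeds it by the radical only.  Since q and r may be
    degenerate, the graph need not be a Lagrangian of q - r, but its image after
    killing the radicals is one. *)
Lemma metabolic_correspondence q r (Z : vectType k)
    (f : Z -> form_support q) (h : Z -> form_support r) :
  linear f -> linear h ->
  (forall z z', q (f z) (f z') = r (h z) (h z')) ->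
  (forall x y, (forall z, q x (f z) = r y (h z)) ->
     exists z, (forall x', q (x - f z) x' = 0) /\
               (forall y', r (y - h z) y' = 0)) ->
  metabolic (osum (regularization q) (oform (regularization r))).
Proof.
move=> f_lin h_lin fh perp; split.
  apply: nondegenerate_osum; first exact: regularization_nondegenerate.
  exact/nondegenerate_oform/regularization_nondegenerate.
pose pq := vquot_pi (orthov q fullv); pose pr := vquot_pi (orthov r fullv).
pose F z : form_support (osum (regularization q) (oform (regularization r))) :=
  (pq (f z), pr (h z)).
have F_lin : linear F.
  by move=> a z z'; rewrite /F /pq /pr f_lin h_lin !linearP.
have FE := linear_lfunE F_lin.
exists (limg (linfun F)); apply/vspaceP => u; apply/idP/mem_orthovP => [|uN].
  case/memv_imgP => z _ ->; rewrite FE => v /memv_imgP[z' _ ->].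
  by rewrite FE osum_oformE !regularizationE fh subrr.
case: u uN => [x y] uN.
have /perp[z [xz yz]] :
    forall z, q (vquot_repr x) (f z) = r (vquot_repr y) (h z).
  move=> z; have := uN _ (memv_img (linfun F) (memvf z)); rewrite FE.
  rewrite osum_oformE /= -{1}[x]vquot_reprK -{1}[y]vquot_reprK.
  by rewrite !reg_valE => /eqP; rewrite subr_eq0 => /eqP.
apply/memv_imgP; exists z; first exact: memvf.
rewrite FE -[x]vquot_reprK -[y]vquot_reprK; congr (_, _);
  by apply/vquot_piP/mem_orthovP => v _.
Qed.

(** If q' - r' is metabolic for the regularizations q', r', then
    q' + (r' - r') = r' + (q' - r') exhibits both as stably equal; r' - r' is
    metabolic because the diagonal is a Lagrangian. *)
Lemma witt_correspondence q r (Z : vectType k)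
    (f : Z -> form_support q) (h : Z -> form_support r) :
  linear f -> linear h ->
  (forall z z', q (f z) (f z') = r (h z) (h z')) ->
  (forall x y, (forall z, q x (f z) = r y (h z)) ->
     exists z, (forall x', q (x - f z) x' = 0) /\
               (forall y', r (y - h z) y' = 0)) ->
  same_witt_class q r.
Proof.
move=> f_lin h_lin fh perp.
(* The diagonal is the correspondence given by two identity maps. *)
have diag : metabolic (osum (regularization r) (oform (regularization r))).
  apply: (@metabolic_correspondence r r (form_support r) id id) => // x y xy.
  exists y; split=> z; rewrite ?subrr ?linear0l //.
  by rewrite linearBl /= xy subrr.
have corr := metabolic_correspondence f_lin h_lin fh perp.
exists (osum (regularization r) (oform (regularization r))).
exists (osum (regularization q) (oform (regularization r))); split=> //.
apply: isometric_trans (osumA _ _ _) _.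
apply: isometric_trans (isometric_osum (osumC _ _) (isometric_refl _)) _.
exact: isometric_sym (osumA _ _ _).
Qed.

Lemma same_witt_class_isometric q r : isometric q r -> same_witt_class q r.
Proof.
case=> f [f' fK Kf] f_iso.
apply: (@witt_correspondence q r (form_support q) id f) => //.
  exact: linearP.
move=> x y xy; exists x; split=> z; first by rewrite subrr linear0l.
rewrite -[z]Kf linearBl /= -xy; apply/eqP; rewrite subr_eq0.
exact/eqP/esym/f_iso.
Qed.

Lemma isometric_oform q r : isometric q r -> isometric (oform q) (oform r).
Proof.
by case=> f f_bij f_iso; exists f => // u v; congr (- _); apply: f_iso.
Qed.

End WittCorrespondence.

(** * Polygons with sides in prescribed Lagrangians *)

Section Polygons.
Variables (k : fieldType) (g : nat).
Implicit Types (s : seq {vspace hyp k g}).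

(** Vertices are indexed by all naturals so that no casts between ordinal types
    appear when sequences are concatenated; [inord] sends an index beyond n to
    0, where the vertex of a polygon vanishes. *)
Definition point n (P : {ffun 'I_n.+1 -> hyp k g}) (i : nat) : hyp k g :=
  P (inord i).

Lemma point_linear n i : linear ((@point n)^~ i).
Proof. by move=> c P Q; rewrite /point !ffunE. Qed.

Definition point_side n (i : nat) (P : {ffun 'I_n.+1 -> hyp k g}) : hyp k g :=
  point P i.+1 - point P i.

Lemma point_side_linear n i : linear (@point_side n i).
Proof.
by move=> c P Q; rewrite /point_side !point_linear scalerBr opprD addrACA.
Qed.

Definition polygon s : {vspace {ffun 'I_(size s).+1 -> hyp k g}} :=
  (lker (linfun ((@point (size s))^~ 0%N)) :&:
   lker (linfun ((@point (size s))^~ (size s))) :&: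
   \bigcap_(i < size s) (linfun (@point_side (size s) i) @^-1: path_at s i))%VS.

Lemma polygonP s P :
  reflect
    [/\ point P 0 = 0, point P (size s) = 0 &
      forall i, (i < size s)%N -> point P i.+1 - point P i \in path_at s i]
    (P \in polygon s).
Proof.
have sideE i : (P \in (linfun (@point_side (size s) i) @^-1: path_at s i)%VS)
             = (point P i.+1 - point P i \in path_at s i).
  by rewrite -memv_preim linear_lfunE //; apply: point_side_linear.
rewrite /polygon !memv_cap !memv_ker !linear_lfunE; try exact: point_linear.
apply: (iffP andP) => [[/andP[/eqP P0 /eqP Pn] Ps]|[P0 Pn Ps]]; split=> //.
- move=> i lti; rewrite -sideE; move: P Ps {P0 Pn sideE}; apply/subvP.
  exact: (bigcapv_inf (Ordinal lti)).
- by rewrite P0 Pn eqxx.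
rewrite memvE; apply/subv_bigcapP => i _; rewrite -memvE sideE; exact: Ps.
Qed.

Definition vertex s (U : subvs_of (polygon s)) (i : nat) : hyp k g :=
  point (vsval U) i.

Lemma vertex_linear s i : linear ((@vertex s)^~ i).
Proof. by move=> c U V; rewrite /vertex linearP point_linear. Qed.

Lemma vertexB s (U V : subvs_of (polygon s)) i :
  vertex (U - V) i = vertex U i - vertex V i.
Proof. by rewrite addrC -scaleN1r vertex_linear scaleN1r addrC. Qed.

Lemma vertex0 s (U : subvs_of (polygon s)) : vertex U 0 = 0.
Proof. by have /polygonP[] := subvsP U. Qed.

Lemma vertex_ge s (U : subvs_of (polygon s)) i :
  (size s <= i)%N -> vertex U i = 0.
Proof.
have /polygonP[U0 Un _] := subvsP U.
rewrite leq_eqVlt => /predU1P[<- //|lti]; rewrite -[RHS]U0 /vertex /point.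
suff -> : inord i = inord 0 :> 'I_(size s).+1 by [].
by apply: val_inj; rewrite /inord !val_insubd /= ltnS leqNgt lti.
Qed.

Lemma side_mem s (U : subvs_of (polygon s)) i : (i < size s)%N ->
  vertex U i.+1 - vertex U i \in path_at s i.
Proof. by have /polygonP[_ _] := subvsP U; apply. Qed.

Lemma vertex_inj s (U V : subvs_of (polygon s)) :
  (forall i, vertex U i = vertex V i) -> U = V.
Proof.
move=> UV; apply/val_inj/ffunP => i; have := UV i.
by rewrite /vertex /point inord_val.
Qed.

(** Projecting onto the space of polygons makes this total; it has the vertices
    f i only when these do form a polygon, see [polygon_ofE]. *)
Definition polygon_of s (f : nat -> hyp k g) : subvs_of (polygon s) :=
  vsproj (polygon s) [ffun i : 'I_(size s).+1 => f i].

Lemma polygon_ofE s (f : nat -> hyp k g) :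
  f 0%N = 0 -> (forall i, (size s <= i)%N -> f i = 0) ->
  (forall i, (i < size s)%N -> f i.+1 - f i \in path_at s i) ->
  forall i, vertex (polygon_of s f) i = f i.
Proof.
move=> f0 fn fs.
have ptE i : (i <= size s)%N -> point [ffun i : 'I_(size s).+1 => f i] i = f i.
  by move=> lti; rewrite /point ffunE inordK.
have fP : [ffun i : 'I_(size s).+1 => f i] \in polygon s.
  apply/polygonP; rewrite !ptE // f0 fn //; split=> // i lti.
  by rewrite !ptE ?fs // ltnW.
move=> i; case: (leqP (size s) i) => [lei|/ltnW lti].
  by rewrite vertex_ge // fn.
by rewrite /vertex vsprojK // ptE.
Qed.

(** * The area form *)

Lemma sum_pick (V : nmodType) n c (F : nat -> V) : (c < n)%N ->
  (forall i, (i < n)%N -> i != c -> F i = 0) -> \sum_(0 <= i < n) F i = F c.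
Proof.
move=> ltc F0; rewrite big_mkord (bigD1 (Ordinal ltc)) //=.
rewrite big1 ?addr0 // => i ic; exact: (F0 i (ltn_ord i) ic).
Qed.

Lemma sum_tail0 (V : nmodType) m n (F : nat -> V) : (m <= n)%N ->
  (forall i, (m <= i)%N -> F i = 0) ->
  \sum_(0 <= i < n) F i = \sum_(0 <= i < m) F i.
Proof.
move=> lemn F0; rewrite (big_cat_nat (n := m)) //= [X in _ + X]big_nat_cond.
by rewrite [X in _ + X]big1 ?addr0 // => i; rewrite andbT => /andP[/F0].
Qed.

Lemma sum_head0 (V : nmodType) m n (F : nat -> V) : (m <= n)%N ->
  (forall i, (i < m)%N -> F i = 0) ->
  \sum_(0 <= i < n) F i = \sum_(0 <= i < n - m) F (m + i)%N.
Proof.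
move=> lemn F0; rewrite (big_cat_nat (n := m)) //= [X in X + _]big_nat_cond.
rewrite [X in X + _]big1 ?add0r => [|i].
  by rewrite -{1}[m]add0n big_addn; apply: eq_bigr => i _; rewrite addnC.
by rewrite andbT => /andP[_ /F0].
Qed.

Lemma sum_omega_pick n c (V : nat -> hyp k g) v : (c < n)%N ->
  \sum_(0 <= i < n) omega k g (V i) (v *+ (i == c)) = omega k g (V c) v.
Proof.
move=> ltc; rewrite (@sum_pick _ _ c) ?eqxx // => i _ /negbTE->.
exact: linear0r.
Qed.

Local Notation omega := (omega k g).

Lemma omegaDl u v w : omega (u + v) w = omega u w + omega v w.
Proof. exact: linearDl. Qed.

Lemma sum_omegaD n (V A B : nat -> hyp k g) :
  \sum_(0 <= i < n) omega (V i) (A i + B i)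
  = \sum_(0 <= i < n) omega (V i) (A i) + \sum_(0 <= i < n) omega (V i) (B i).
Proof. by rewrite -big_split; apply: eq_bigr => i _; apply: omegaDr. Qed.

Lemma sum_omega_pick3 n c d e (V : nat -> hyp k g) v w x :
  (c < n)%N -> (d < n)%N -> (e < n)%N ->
  \sum_(0 <= i < n)
     omega (V i) (v *+ (i == c) + w *+ (i == d) + x *+ (i == e))
  = omega (V c) v + omega (V d) w + omega (V e) x.
Proof.
move=> ltc ltd lte; rewrite sum_omegaD sum_omegaD.
by congr (_ + _ + _); apply: sum_omega_pick.
Qed.

Definition area s (U V : subvs_of (polygon s)) : k :=
  \sum_(0 <= i < size s) omega (vertex U i) (vertex V i.+1 - vertex V i).

Lemma area_linear s (V : subvs_of (polygon s)) : 
  linear ((@area s)^~ V : _ -> k^o).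
Proof.
move=> c U W; rewrite /area scaler_sumr -big_split; apply: eq_bigr => i _.
by rewrite vertex_linear linearDl linearZl_LR.
Qed.

(** The i-th sides of P and Q lie in the same Lagrangian, so that
    omega(P_i, Q_(i+1) - Q_i) - omega(Q_i, P_(i+1) - P_i) is the increment of
    omega(P_i, Q_i); these increments sum to 0 around a closed polygon. *)
Lemma area_sym s (U V : subvs_of (polygon s)) :
  all (@lagrangian k g) s -> area U V = area V U.
Proof.
move=> lag_s; apply/eqP; rewrite -subr_eq0 /area -sumrB.
rewrite (eq_big_nat _ _ (F2 := fun i =>
  omega (vertex U i.+1) (vertex V i.+1) - omega (vertex U i) (vertex V i))).
  by rewrite telescope_sumr // !(@vertex_ge s _ (size s)) // !vertex0 subrr.
move=> i /andP[_ lti].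
have := lagrangian_isotropic (allP lag_s _ (mem_nth 0%VS lti))
  (side_mem U lti) (side_mem V lti).
rewrite !omegaBr !omegaBl [omega (vertex V _) _]omegaC.
rewrite [omega (vertex V i) (vertex U i)]omegaC => e.
rewrite -[RHS]subr0 -e; ring.
Qed.

Definition area_form s (lag_s : all (@lagrangian k g) s) : sym_form k :=
  SymForm (make_sym (@area_linear s) (fun U V => area_sym U V lag_s)).

Lemma area_formE s (lag_s : all (@lagrangian k g) s) U V :
  area_form lag_s U V = area U V.
Proof. by []. Qed.

Lemma mem_mulrb (X : {vspace hyp k g}) v (b : bool) :
  (b -> v \in X) -> v *+ b \in X.
Proof. by case: b => [->|_]; rewrite ?mulr1n ?mulr0n ?mem0v. Qed.

Lemma step_mulrb (V : zmodType) (v : V) c i :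
  v *+ (c < i.+1)%N - v *+ (c < i)%N = v *+ (i == c).
Proof.
by rewrite ltnS leq_eqVlt eq_sym; case: ltngtP => _; rewrite ?subrr ?subr0.
Qed.

Lemma sub_sum3 (V : zmodType) (a b c a' b' c' : V) :
  a + b + c - (a' + b' + c') = (a - a') + (b - b') + (c - c').
Proof. by rewrite opprD addrACA opprD [X in X + _]addrACA. Qed.

(** The polygons that test orthogonality below: only the sides 0, 1 and i are
    nonzero. *)
Lemma test_triangle s i c0 c1 u : (1 < i < size s)%N ->
  c0 \in path_at s 0 -> c1 \in path_at s 1 -> u \in path_at s i ->
  c0 + c1 + u = 0 ->
  exists U : subvs_of (polygon s), forall j,
    vertex U j.+1 - vertex U j
    = c0 *+ (j == 0)%N + c1 *+ (j == 1)%N + u *+ (j == i).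
Proof.
move=> /andP[lt1i lti] c0P c1P uP sum0.
pose f j := c0 *+ (0 < j)%N + c1 *+ (1 < j)%N + u *+ (i < j)%N.
have fS j : f j.+1 - f j = c0 *+ (j == 0)%N + c1 *+ (j == 1)%N + u *+ (j == i).
  rewrite -(step_mulrb c0 0) -(step_mulrb c1 1) -(step_mulrb u i).
  by rewrite /f sub_sum3.
suff UE : forall j, vertex (polygon_of s f) j = f j.
  by exists (polygon_of s f) => j; rewrite !UE fS.
apply: polygon_ofE.
- by rewrite /f !ltn0 !mulr0n !addr0.
- move=> l lel; have lt_il := leq_trans lti lel.
  have lt1l := ltn_trans lt1i lt_il.
  by rewrite /f lt_il lt1l (ltnW lt1l).
move=> l _; rewrite fS.
by rewrite !rpredD // mem_mulrb // => /eqP->.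
Qed.

(** An open chain V with sides along s, orthogonal to all polygons along s, is
    a polygon up to a translation and a change at its ends: all its chords from
    V_1 to V_i lie in the i-th Lagrangian.  To see this for a given i, note that
    any side u in the i-th Lagrangian completes to a triangle with sides in the
    first two, because these are transverse; the area of V against that
    triangle is omega(V_i - V_1, u).  The last side of V is unconstrained, so
    that the statement applies to pieces of longer polygons. *)
Lemma polar_polygon s (V : nat -> hyp k g) :
  all (@lagrangian k g) s -> (1 < size s)%N ->
  transverse (path_at s 0) (path_at s 1) ->
  (forall i, (i.+1 < size s)%N -> V i.+1 - V i \in path_at s i) ->
  (forall U : subvs_of (polygon s),
     \sum_(0 <= i < size s) omega (V i) (vertex U i.+1 - vertex U i) = 0) ->
  exists U : subvs_of (polygon s),
    forall i, vertex U i = (V i - V 1) *+ (0 < i < size s)%N.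
Proof.
move=> lag_s size_s tr_s sideV perpV.
have lag i : (i < size s)%N -> lagrangian (path_at s i).
  by move=> lti; apply: (allP lag_s); apply: mem_nth.
have chord i : (0 < i < size s)%N -> V i - V 1 \in path_at s i.
  case: i => [//|[|i]] /= lti; first by rewrite subrr mem0v.
  apply/(lagrangian_mem _ (lag _ lti)) => u uP.
  have /memv_addP[c0 c0P [c1 c1P c01]] :
    - u \in (path_at s 0 + path_at s 1)%VS by rewrite (eqP tr_s) memvf.
  have [||U UE] := @test_triangle s i.+2 c0 c1 u _ c0P c1P uP.
  - exact: lti.
  - by rewrite -c01 addNr.
  have := perpV U.
  rewrite (eq_bigr _ (fun j _ => congr1 (omega (V j)) (UE j))).
  rewrite (sum_omega_pick3 V c0 c1 u (ltnW size_s) size_s lti).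
  have -> : omega (V 0%N) c0 = omega (V 1%N) c0.
    apply/eqP; rewrite eq_sym -subr_eq0 -omegaBl.
    by rewrite (lagrangian_isotropic (lag 0%N (ltnW size_s))) ?sideV.
  by rewrite -linearDr -c01 linearNr addrC -omegaBl.
exists (polygon_of s (fun i => (V i - V 1%N) *+ (0 < i < size s)%N)) => i.
rewrite polygon_ofE // => [l lel|l ltl].
  by rewrite [(l < _)%N]ltnNge lel andbF.
rewrite ltl andbT /=; case: l ltl => [|l] ltl.
  by rewrite size_s subrr subr0 mem0v.
rewrite /= mulr1n; case: ltnP => ltSl; first by rewrite opprB addrA subrK sideV.
by rewrite mulr0n sub0r rpredN chord.
Qed.

(** * The Sylvester form as an area form *)

Section SylvesterPolygon.
Variables (X Y : {vspace hyp k g}) (p : lag_path X Y).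
Local Notation n := (syl_size p).

Lemma size_path : size p = n.+2.
Proof. by rewrite /syl_size -addn2 subnK // path_size. Qed.

Lemma ltn_size_path i : (i < size p)%N = (i <= n.+1)%N.
Proof. by rewrite size_path ltnS. Qed.

Lemma lagrangian_at i : (i < size p)%N -> lagrangian (path_at p i).
Proof. by move=> lti; apply: (allP (path_lagrangian p)); apply: mem_nth. Qed.

Lemma transverse_at i : (i.+1 < size p)%N ->
  transverse (path_at p i) (path_at p i.+1).
Proof.
have := path_transverse p; rewrite /path_at.
by case: (path_seq p) => // x t /= /(pathP 0%VS) tr lti; apply: tr.
Qed.

(** The i-th vertex is the sum of a vector of X_i restricting on X_(i-1) to
    a_(i-1), and one of X_(i-1) restricting on X_i to a_i, where
    a_j : X_j -> k is the component of a at X_j, for X_j interior, and 0 for the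
    two ends of the path.  The sums have at most one term; indexing by j avoids
    casts, since the type of the component at j depends on j.  Component
    j : 'I_n belongs to X_(j+1), whence the shifts. *)
Definition syl_vertex (a : syl_support p) (i : nat) : hyp k g :=
    \sum_(j < n | i == j.+2)
      vsval ((beta (path_at p i) (syl_lag j))^-1%VF (dsum_at a j))
  + \sum_(j < n | i == j.+1)
      vsval ((beta (path_at p i.-1) (syl_lag j))^-1%VF (dsum_at a j)).

Lemma sum_vsval_mem (Z : {vspace hyp k g}) (P : pred 'I_n)
    (F : 'I_n -> subvs_of Z) :
  \sum_(j < n | P j) vsval (F j) \in Z.
Proof. by apply: rpred_sum => j _; apply: subvsP. Qed.

Lemma syl_size_at (j : 'I_n) : (j.+2 < size p)%N.
Proof. by rewrite size_path !ltnS. Qed.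

(** Of the two summands of the vertex, the one in X_(j+1) is killed by
    isotropy. *)
Lemma syl_vertex_before a (j : 'I_n) (x : subvs_of (syl_lag j)) :
  omega (syl_vertex a j.+1) (vsval x) = dsum_at a j x.
Proof.
have szj := syl_size_at j.
rewrite /syl_vertex omegaDl.
rewrite (lagrangian_isotropic (lagrangian_at (ltnW szj)))
  ?sum_vsval_mem ?subvsP //.
rewrite add0r (big_pred1 j) => [|j']; last by rewrite /= eqSS eq_sym.
rewrite -betaE beta_invK //; first exact: lagrangian_at (ltnW (ltnW szj)).
  exact: lagrangian_at (ltnW szj).
exact: transverse_at (ltnW szj).
Qed.

(** Row j of the Sylvester matrix is a difference of two vertices: the diagonal
    block, being a difference of two inverses, gives one summand to each. *)
Lemma syl_vertex_side a (j : 'I_n) :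
  vsval (dsum_at (syl_map a) j) = syl_vertex a j.+2 - syl_vertex a j.+1.
Proof.
have szj := syl_size_at j.
have lag_j := lagrangian_at (ltnW szj).
have lag_j0 := lagrangian_at (ltnW (ltnW szj)).
have tr_j0 := transverse_at (ltnW szj).
have := transverse_at szj; rewrite transverseC => tr_j2.
rewrite syl_mapE linearB linearD /= !linear_sum.
rewrite (dmapE _ lag_j lag_j0 (lagrangian_at szj) tr_j0 tr_j2).
rewrite /syl_vertex [in RHS](big_pred1 j) => [|j'].
  2: by rewrite /= !eqSS eq_sym.
rewrite [X in _ = _ + _ - (_ + X)](big_pred1 j) => [|j'].
  2: by rewrite /= eqSS eq_sym.
rewrite [in RHS]addrC [in RHS]opprD.
rewrite -addrA [RHS]addrC [X in _ = _ + X]addrC [RHS]addrACA.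
congr (_ + (_ + _)); first by apply: eq_bigl => i; rewrite eqSS eq_sym.
by rewrite -sumrN; apply: eq_bigl => i; rewrite !eqSS.
Qed.

Lemma syl_vertex0 a : syl_vertex a 0 = 0.
Proof. by rewrite /syl_vertex !big_pred0 ?addr0. Qed.

Lemma syl_vertex_ge a i : (size p <= i)%N -> syl_vertex a i = 0.
Proof.
rewrite size_path => lei.
have ltj (j : 'I_n) : (j.+2 < i)%N by apply: leq_trans lei; rewrite !ltnS.
rewrite /syl_vertex !big_pred0 ?addr0 // => j;
  by rewrite gtn_eqF // ?(ltj j) // ltnW ?(ltj j).
Qed.

Lemma syl_vertex_mem a i : (i < size p)%N ->
  syl_vertex a i.+1 - syl_vertex a i \in path_at p i.
Proof.
case: i => [_|i].
  rewrite syl_vertex0 subr0 /syl_vertex big_pred0 ?add0r //.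
  exact: sum_vsval_mem.
rewrite size_path !ltnS leq_eqVlt => /predU1P[->|lti].
  rewrite syl_vertex_ge ?size_path // sub0r rpredN /syl_vertex.
  rewrite [X in _ + X]big_pred0 ?addr0 ?sum_vsval_mem // => j.
  by rewrite eqSS gtn_eqF.
have := syl_vertex_side a (Ordinal lti); rewrite /= => <-.
exact: subvsP.
Qed.

Definition restrict_omega (U : subvs_of (polygon p)) : syl_support p :=
  dsum_of (fun j : 'I_n =>
    linfun (fun x : subvs_of (syl_lag j) =>
              omega (vertex U j.+1) (vsval x) : k^o)
    : dual (subvs_of (syl_lag j))).

Lemma restrict_omegaE U (j : 'I_n) x :
  dsum_at (restrict_omega U) j x = omega (vertex U j.+1) (vsval x).
Proof.
rewrite /restrict_omega dsum_ofE linear_lfunE // => c u v.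
by rewrite linearP.
Qed.

Lemma restrict_omega_linear : linear restrict_omega.
Proof.
move=> c U V; apply/dsumP => j; rewrite dsum_atP; apply/lfunP => x.
rewrite add_lfunE scale_lfunE !restrict_omegaE vertex_linear.
by rewrite omegaDl linearZl_LR.
Qed.

Definition syl_polygon (a : syl_support p) : subvs_of (polygon p) :=
  polygon_of p (syl_vertex a).

Lemma vertex_syl_polygon a i : vertex (syl_polygon a) i = syl_vertex a i.
Proof.
apply: polygon_ofE; [exact: syl_vertex0 | exact: syl_vertex_ge |].
exact: syl_vertex_mem.
Qed.

Lemma syl_polygonK : cancel syl_polygon restrict_omega.
Proof.
move=> a; apply/dsumP => j; apply/lfunP => x.
by rewrite restrict_omegaE vertex_syl_polygon syl_vertex_before.
Qed.

(** If omega(P_i, -) vanishes on X_i for all interior i, then it does so for all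
    i, since the first and last vertices lie in X_0 and X_N.  As the side from
    P_i to P_(i+1) is in X_i, also omega(P_(i+1), -) vanishes on X_i, hence on
    X_i + X_(i+1), the whole space. *)
Lemma restrict_omega_inj0 U : restrict_omega U = 0 -> U = 0.
Proof.
move=> U0.
have vertexU0 i x :
    (i < size p)%N -> x \in path_at p i -> omega (vertex U i) x = 0.
  case: i => [|i] lti xP; first by rewrite vertex0 linear0l.
  move: lti; rewrite size_path !ltnS leq_eqVlt => /predU1P[ei|lti].
    have ltSi : (i.+1 < size p)%N by rewrite size_path ei.
    have := side_mem U ltSi; rewrite vertex_ge ?size_path ?ei // sub0r rpredN.
    rewrite -ei => UP.
    exact: lagrangian_isotropic (lagrangian_at ltSi) UP xP.
  have /= := @restrict_omegaE U (Ordinal lti) (vsproj (path_at p i.+1) x).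
  by rewrite U0 dsum_ofE zero_lfunE vsprojK.
apply: vertex_inj => i.
have z0 : vertex (0 : subvs_of (polygon p)) i = 0.
  by rewrite -(subrr U) vertexB subrr.
rewrite z0; case: i {z0} => [|i]; first exact: vertex0.
case: (ltnP i.+1 (size p)) => [lti|/vertex_ge-> //].
apply: omega_nondegenerate => v.
have /memv_addP[x xP [y yP ->]] :
  v \in (path_at p i + path_at p i.+1)%VS.
  by rewrite (eqP (transverse_at lti)) memvf.
rewrite omegaDr [X in _ + X]vertexU0 // addr0.
rewrite -[vertex U i.+1](subrK (vertex U i)) omegaDl.
rewrite [X in _ + X]vertexU0 ?addr0 ?(ltnW lti) //.
exact: lagrangian_isotropic (lagrangian_at (ltnW lti))
  (side_mem U (ltnW lti)) xP.
Qed.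

Lemma restrict_omegaK : cancel restrict_omega syl_polygon.
Proof.
move=> U; apply/eqP; rewrite -subr_eq0; apply/eqP/restrict_omega_inj0.
have -> : syl_polygon (restrict_omega U) - U =
    -1 *: U + syl_polygon (restrict_omega U).
  by rewrite scaleN1r addrC.
by rewrite restrict_omega_linear syl_polygonK scaleN1r addNr.
Qed.

Lemma area_form_sylvester :
  isometric (area_form (path_lagrangian p)) (sylvester p).
Proof.
apply: (@isometricI k (area_form (path_lagrangian p)) (sylvester p)
  restrict_omega).
- exact: restrict_omega_linear.
- by exists syl_polygon; [exact: restrict_omegaK | exact: syl_polygonK].
move=> U V; rewrite area_formE.
transitivity (syl_val (restrict_omega U) (restrict_omega V)); first by [].
rewrite (area_sym _ _ (path_lagrangian p)) /area size_path.
(* The end terms vanish: the initial vertex is 0, and the last vertex and the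
   last side lie in the same Lagrangian. *)
rewrite big_nat_recl // big_nat_recr // vertex0 linear0l add0r.
have sz : (n.+1 < size p)%N by rewrite size_path.
have sideV W := side_mem W sz.
have lastV : vertex V n.+1 \in path_at p n.+1.
  by have := sideV V; rewrite vertex_ge ?size_path // sub0r rpredN.
rewrite [X in _ = _ + X](lagrangian_isotropic (lagrangian_at sz)) ?sideV //.
rewrite addr0 big_mkord /syl_val; apply: eq_bigr => j _.
rewrite restrict_omegaE syl_vertex_side -!vertex_syl_polygon restrict_omegaK.
by [].
Qed.

End SylvesterPolygon.

(** * Gluing polygons along a concatenation *)

Lemma vertex_zero s i : vertex (0 : subvs_of (polygon s)) i = 0.
Proof. by rewrite -(subrr (0 : subvs_of (polygon s))) vertexB subrr. Qed.

Lemma path_first (X Y : {vspace hyp k g}) (p : lag_path X Y) : path_at p 0 = X.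
Proof. by rewrite /path_at nth0 path_head. Qed.

Lemma path_final (X Y : {vspace hyp k g}) (p : lag_path X Y) :
  path_at p (syl_size p).+1 = Y.
Proof. by have := path_last p; rewrite -nth_last size_path. Qed.

(** Translating a chain does not change its area against a closed polygon, so
    only the discrepancy d - c between the translations of its initial vertex
    and of the others contributes. *)
Lemma sum_translate s (U : subvs_of (polygon s)) (V W : nat -> hyp k g) c d :
  (0 < size s)%N -> V 0%N = W 0%N + d ->
  (forall i, (0 < i < size s)%N -> V i = W i + c) ->
  \sum_(0 <= i < size s) omega (V i) (vertex U i.+1 - vertex U i)
  = \sum_(0 <= i < size s) omega (W i) (vertex U i.+1 - vertex U i)
    + omega (d - c) (vertex U 1).
Proof.
move=> size_s V0 VS; have Un := vertex_ge U (leqnn (size s)).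
case: (size s) size_s VS Un => [//|n] _ VS Un.
rewrite !big_nat_recl // V0 vertex0 subr0 omegaDl omegaBl.
rewrite (eq_big_nat _ _ (F2 := fun i =>
  omega (W i.+1) (vertex U i.+2 - vertex U i.+1)
  + (omega c (vertex U i.+2) - omega c (vertex U i.+1)))); last first.
  by move=> i /andP[_ lti]; rewrite VS ?ltnS // omegaDl [X in _ + X]omegaBr.
have splitE (F G : nat -> k) : \sum_(0 <= i < n) (F i + G i)
    = \sum_(0 <= i < n) F i + \sum_(0 <= i < n) G i by exact: big_split.
rewrite splitE telescope_sumr // Un linear0r sub0r.
exact: addrACA.
Qed.

Lemma first_vertex_mem (X Y : {vspace hyp k g}) (c : lag_path X Y)
  (S : subvs_of (polygon c)) : vertex S 1 \in X.
Proof.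
have := @side_mem c S 0%N; rewrite vertex0 subr0 path_first size_path.
by apply.
Qed.

Lemma last_vertex_mem (X Y : {vspace hyp k g}) (c : lag_path X Y)
  (S : subvs_of (polygon c)) : vertex S (syl_size c).+1 \in Y.
Proof.
have := @side_mem c S (syl_size c).+1; rewrite path_final size_path.
by rewrite vertex_ge ?size_path // sub0r rpredN; apply.
Qed.

Section Concatenation.
Variables (L0 L1 L2 : {vspace hyp k g}).
Hypotheses (lag0 : lagrangian L0) (lag1 : lagrangian L1) (lag2 : lagrangian L2).
Variables (a : lag_path L0 L1) (b : lag_path L1 L2).
Local Notation p := (syl_size a).+1.
Local Notation r := (syl_size b).+1.
Local Notation ab := (path_concat a b).
Local Notation triangle := [:: L0; L1; L2].

Lemma triangle_lagrangian : all (@lagrangian k g) triangle.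
Proof. by rewrite /= lag0 lag1 lag2. Qed.

Lemma triangle_vertex1 (S : subvs_of (polygon triangle)) : vertex S 1 \in L0.
Proof. by have := @side_mem triangle S 0%N isT; rewrite vertex0 subr0. Qed.

Lemma triangle_vertex12 (S : subvs_of (polygon triangle)) :
  vertex S 2 - vertex S 1 \in L1.
Proof. exact: (@side_mem triangle S 1%N isT). Qed.

Lemma triangle_vertex2 (S : subvs_of (polygon triangle)) : vertex S 2 \in L2.
Proof.
have := @side_mem triangle S 2%N isT.
by rewrite [vertex S 3]vertex_ge // sub0r rpredN.
Qed.

Lemma size_concat : size ab = (p + r).+1.
Proof. by rewrite size_cat size_behead !size_path addSn. Qed.

Lemma path_at_left i : (i <= p)%N -> path_at ab i = path_at a i.
Proof. by move=> lei; rewrite /path_at nth_cat size_path ltnS lei. Qed.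

Lemma path_at_right j : path_at ab (p + j) = path_at b j.
Proof.
case: j => [|j]; first by rewrite addn0 path_at_left // path_final path_first.
rewrite /path_at nth_cat size_path ltnNge addnS ltnS leq_addr /=.
by rewrite subSS addKn nth_behead.
Qed.

(** Collapses the vertices of the concatenated path onto those of the triangle:
    0, then 1 along a, 2 along b, and 3 at the end. *)
Definition corner (i : nat) : nat := ((0 < i) + (p < i) + (p + r < i))%N.

Lemma corner_left i : (0 < i <= p)%N -> corner i = 1%N.
Proof.
case/andP=> i0 lei; rewrite /corner i0 ltnNge lei ltnNge.
by rewrite (leq_trans lei (leq_addr _ _)).
Qed.

Lemma corner_right j : (0 < j <= r)%N -> corner (p + j) = 2%N.
Proof.
case/andP=> j0 lej; rewrite /corner ltn_add2l [(r < j)%N]ltnNge lej.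
by rewrite [(p < _)%N](_ : _ = true) // -[X in (X < _)%N]addn0 ltn_add2l.
Qed.

Lemma corner_ge i : (p + r < i)%N -> corner i = 3%N.
Proof.
move=> lti; rewrite /corner lti (leq_ltn_trans (leq_addr _ _) lti).
by rewrite (leq_ltn_trans (leq0n _) lti).
Qed.

Lemma corner_side (T : subvs_of (polygon triangle)) i :
  vertex T (corner i.+1) - vertex T (corner i)
  = (vertex T 1 - vertex T 0) *+ (i == 0)%N
    + (vertex T 2 - vertex T 1) *+ (i == p)%N
    + (vertex T 3 - vertex T 2) *+ (i == p + r)%N.
Proof.
have lt_pr : (p < p + r)%N by rewrite -[X in (X < _)%N]addn0 ltn_add2l.
case: (posnP i) => [->|i0].
  by rewrite corner_left // /corner ltn0 mulr1n !mulr0n !addr0.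
rewrite mulr0n add0r.
case: (ltngtP i p) => [ltip|ltpi|->].
- rewrite !corner_left ?i0 ?(ltnW ltip) //.
  by rewrite subrr [(i == _)%N]ltn_eqF ?addr0 // (ltn_trans ltip).
- rewrite mulr0n add0r -(subnKC (ltnW ltpi)) -addnS eqn_add2l.
  have : (0 < i - p)%N by rewrite subn_gt0.
  move: (i - p)%N => j j0; case: (ltngtP j r) => [ltj|ltj|->].
  + by rewrite !corner_right ?j0 ?(ltnW ltj) // subrr.
  + by rewrite !corner_ge ?ltn_add2l ?(ltnW ltj) ?subrr // ltnW.
  + by rewrite (@corner_right r) ?leqnn // corner_ge ?ltn_add2l.
rewrite [(p == _)%N]ltn_eqF // -addn1 corner_right // corner_left ?leqnn //.
by rewrite mulr0n addr0 mulr1n.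
Qed.

(** Each of the three polygons is seen as a polygon along the concatenated path
    by inserting zero sides: [vertex U] is 0 beyond the end of a, the
    truncated i - p stays at the initial vertex of W along a, and [corner]
    jumps only at the three sides along L0, L1 and L2. *)
Definition glue_vertex (U : subvs_of (polygon a)) (W : subvs_of (polygon b))
    (T : subvs_of (polygon triangle)) (i : nat) : hyp k g :=
  vertex U i + vertex W (i - p) + vertex T (corner i).

Lemma glue_vertex0 U W T : glue_vertex U W T 0 = 0.
Proof. by rewrite /glue_vertex sub0n /corner !ltn0 !vertex0 !addr0. Qed.

Lemma glue_vertex_left U W T i : (0 < i <= p)%N ->
  glue_vertex U W T i = vertex U i + vertex T 1.
Proof.
move=> ip; rewrite /glue_vertex corner_left //; case/andP: ip => _.
by rewrite -subn_eq0 => /eqP->; rewrite vertex0 addr0.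
Qed.

Lemma glue_vertex_right U W T j : (0 < j <= r)%N ->
  glue_vertex U W T (p + j) = vertex W j + vertex T 2.
Proof.
move=> jr; rewrite /glue_vertex corner_right // addKn.
rewrite [vertex U _]vertex_ge ?add0r // size_path.
by case/andP: jr => j0 _; rewrite -addn1 leq_add2l.
Qed.

Lemma glue_vertex_ge U W T i : (p + r < i)%N -> glue_vertex U W T i = 0.
Proof.
move=> lti; rewrite /glue_vertex corner_ge // !vertex_ge ?addr0 // size_path.
  by rewrite ltn_subRL.
exact: leq_ltn_trans (leq_addr _ _) lti.
Qed.

Lemma glue_vertex_side U W T i :
  glue_vertex U W T i.+1 - glue_vertex U W T i
  = (vertex U i.+1 - vertex U i) + (vertex W (i.+1 - p) - vertex W (i - p))
    + (vertex T (corner i.+1) - vertex T (corner i)).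
Proof. exact: sub_sum3. Qed.

Lemma glue_vertex_mem U W T i : (i < (p + r).+1)%N ->
  glue_vertex U W T i.+1 - glue_vertex U W T i \in path_at ab i.
Proof.
move=> lti; rewrite glue_vertex_side; apply: rpredD; first apply: rpredD.
- case: (ltnP i p.+1) => lei; last first.
    by rewrite !vertex_ge ?size_path ?subrr ?mem0v // ltnW.
  by rewrite path_at_left // side_mem // size_path.
- case: (ltnP i p) => ltip.
    have /eqP-> : (i.+1 - p == 0)%N by rewrite subn_eq0.
    have /eqP-> : (i - p == 0)%N by rewrite subn_eq0 ltnW.
    by rewrite subrr mem0v.
  have -> : path_at ab i = path_at b (i - p) by rewrite -path_at_right subnKC.
  rewrite subSn // side_mem // size_path.
  by rewrite ltnS leq_subLR.
have triP j := @side_mem triangle T j.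
rewrite corner_side; apply: rpredD; first apply: rpredD;
  apply: mem_mulrb => /eqP->.
- by rewrite path_at_left // path_first; apply: (triP 0%N).
- by rewrite path_at_left // path_final; apply: (triP 1%N).
by rewrite path_at_right path_final; apply: (triP 2%N).
Qed.

Definition glue (z : subvs_of (polygon a) * subvs_of (polygon b)
                     * subvs_of (polygon triangle)) : subvs_of (polygon ab) :=
  polygon_of ab (glue_vertex z.1.1 z.1.2 z.2).

Lemma vertex_glue z i : vertex (glue z) i = glue_vertex z.1.1 z.1.2 z.2 i.
Proof.
apply: polygon_ofE; first exact: glue_vertex0.
  by move=> l; rewrite size_concat; apply: glue_vertex_ge.
by move=> l; rewrite size_concat; apply: glue_vertex_mem.
Qed.

Lemma glue_linear : linear glue.
Proof.
move=> c x y; apply: vertex_inj => i; rewrite vertex_linear !vertex_glue.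
rewrite /glue_vertex /= !vertex_linear !scalerDr.
by rewrite [RHS]addrACA [X in _ = X + _]addrACA.
Qed.

(** Only the nonzero sides of the three pieces contribute. *)
Lemma area_glue (V : subvs_of (polygon ab)) U W T :
  area V (glue (U, W, T))
  = \sum_(0 <= i < size a) omega (vertex V i) (vertex U i.+1 - vertex U i)
  + \sum_(0 <= j < size b)
      omega (vertex V (p + j)) (vertex W j.+1 - vertex W j)
  + (omega (vertex V p) (vertex T 2 - vertex T 1)
     + omega (vertex V (p + r)) (vertex T 3 - vertex T 2)).
Proof.
rewrite /area size_concat.
have sideE i : vertex (glue (U, W, T)) i.+1 - vertex (glue (U, W, T)) i
  = (vertex U i.+1 - vertex U i) + (vertex W (i.+1 - p) - vertex W (i - p))
    + (vertex T (corner i.+1) - vertex T (corner i)).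
  by rewrite !vertex_glue glue_vertex_side.
rewrite (eq_bigr _ (fun i _ => congr1 (omega (vertex V i)) (sideE i))).
rewrite [LHS]sum_omegaD [X in X + _ = _]sum_omegaD; congr (_ + _ + _).
- apply: sum_tail0 => [|i lei]; first by rewrite size_path ltnS leq_addr.
  by rewrite (vertex_ge U lei) (vertex_ge U (leqW lei)) subrr linear0r.
- have lepn : (p <= (p + r).+1)%N by rewrite leqW ?leq_addr.
  rewrite (sum_head0 lepn) => [|i lei].
    have -> : ((p + r).+1 - p)%N = size b by rewrite size_path -addnS addKn.
    by apply: eq_bigr => j _; rewrite -addnS !addKn.
  have /eqP-> : (i.+1 - p == 0)%N by rewrite subn_eq0.
  have /eqP-> : (i - p == 0)%N by rewrite subn_eq0 ltnW.
  by rewrite subrr linear0r.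
rewrite (eq_bigr _ (fun i _ => congr1 (omega (vertex V i)) (corner_side T i))).
rewrite sum_omega_pick3 ?ltnS ?leq_addr //.
by rewrite vertex0 linear0l add0r.
Qed.

(** Along a the glued polygon is U' translated by the first corner of T', except
    at the initial vertex; along b it is W' translated by the second corner,
    except at the vertex shared with a.  In each case the discrepancy of the
    translations lies in the same Lagrangian as the first side it is paired
    with, so it contributes nothing. *)
Lemma area_glue_glue z' z :
  area (glue z') (glue z)
  = area z'.1.1 z.1.1 + area z'.1.2 z.1.2 + area z'.2 z.2.
Proof.
case: z' z => [[U' W'] T'] [[U W] T]; rewrite area_glue.
have isotropic0 := lagrangian_isotropic lag0.
have isotropic1 := lagrangian_isotropic lag1.
have isotropic2 := lagrangian_isotropic lag2.
congr (_ + _ + _).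
- rewrite (@sum_translate _ _ _ (vertex U') (vertex T' 1) 0).
  + by rewrite sub0r isotropic0 ?addr0 ?rpredN ?triangle_vertex1
      ?first_vertex_mem.
  + by rewrite size_path.
  + by rewrite vertex_glue glue_vertex0 vertex0 addr0.
  move=> i; rewrite ltn_size_path => ip.
  by rewrite vertex_glue glue_vertex_left.
- rewrite (@sum_translate _ _ _ (vertex W') (vertex T' 2)
            (vertex U' p + vertex T' 1)).
  + rewrite -addrA -opprB isotropic1 ?addr0 ?first_vertex_mem //.
    by apply: rpredB; [apply: last_vertex_mem | apply: triangle_vertex12].
  + by rewrite size_path.
  + by rewrite vertex_glue addn0 glue_vertex_left ?leqnn // vertex0 add0r.
  move=> j; rewrite ltn_size_path => jr.
  by rewrite vertex_glue glue_vertex_right.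
rewrite /area !vertex_glue glue_vertex_left ?leqnn //.
rewrite glue_vertex_right ?leqnn //.
rewrite !big_nat_recl // big_geq // addr0 vertex0 linear0l add0r.
rewrite !omegaDl isotropic1 ?last_vertex_mem ?triangle_vertex12 // add0r.
congr (_ + _).
rewrite isotropic2 ?add0r ?last_vertex_mem //.
by rewrite vertex_ge // sub0r rpredN triangle_vertex2.
Qed.

(** Orthogonality to the polygons along a and along b alone lets one cut the two
    pieces of V off by their chords; what remains is constant along a and along
    b, that is, a triangle. *)
Lemma glue_polar (V : subvs_of (polygon ab)) :
  (forall z, area V (glue z) = 0) -> exists z, glue z = V.
Proof.
move=> V0.
have sideV i : (i <= p + r)%N -> vertex V i.+1 - vertex V i \in path_at ab i.
  by move=> lei; apply: side_mem; rewrite size_concat ltnS.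
have [U UE] : exists U : subvs_of (polygon a),
    forall i, vertex U i = (vertex V i - vertex V 1) *+ (0 < i < size a)%N.
  apply: polar_polygon (path_lagrangian a) _ _ _ _.
  - by rewrite size_path.
  - by apply: transverse_at; rewrite size_path.
  - move=> i; rewrite ltn_size_path => lei.
    rewrite -path_at_left; last exact: ltnW.
    by apply: sideV; rewrite (leq_trans (ltnW lei)) ?leq_addr.
  move=> U; have := V0 (U, 0, 0); rewrite area_glue.
  rewrite [X in _ + X + _]big1 => [|i _].
    2: by rewrite !vertex_zero subrr linear0r.
  by rewrite !vertex_zero subrr !linear0r !addr0.
have [W WE] : exists W : subvs_of (polygon b),
    forall j, vertex W j =
      (vertex V (p + j) - vertex V (p + 1)) *+ (0 < j < size b)%N.
  apply: (polar_polygon (V := fun j => vertex V (p + j)))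
    (path_lagrangian b) _ _ _ _.
  - by rewrite size_path.
  - by apply: transverse_at; rewrite size_path.
  - move=> j; rewrite ltn_size_path => lej.
    by rewrite -path_at_right addnS; apply: sideV; rewrite leq_add2l ltnW.
  move=> W; have := V0 (0, W, 0); rewrite area_glue.
  rewrite [X in X + _ + _]big1 => [|i _].
    2: by rewrite !vertex_zero subrr linear0r.
  by rewrite !vertex_zero subrr !linear0r !addr0 add0r.
(* After subtraction of U and W, all vertices of V along a become V_1, and all
   those along b become V_(p+1). *)
pose f i := match i with 1 => vertex V 1 | 2 => vertex V (p + 1) | _ => 0 end.
have V1P : vertex V 1 \in L0 by exact: (first_vertex_mem V).
have [T TE] :
    exists T : subvs_of (polygon triangle), forall i, vertex T i = f i.
  exists (polygon_of triangle f); apply: polygon_ofE => //.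
    by case=> [|[|[|i]]].
  case=> [|[|[|i]]] //= _; rewrite ?subr0 ?sub0r ?rpredN //.
    have := last_vertex_mem U; rewrite UE ltn_size_path leqnn mulr1n => VpP.
    have := sideV p (leq_addr _ _).
    rewrite path_at_left // path_final addn1 => VSP.
    by rewrite -(subrK (vertex V p) (vertex V p.+1)) -addrA rpredD.
  have := last_vertex_mem W; rewrite WE ltn_size_path leqnn mulr1n => VrP.
  have := sideV (p + r)%N (leqnn _); rewrite path_at_right path_final.
  rewrite vertex_ge ?size_concat // sub0r rpredN => VprP.
  by rewrite -(subKr (vertex V (p + r)) (vertex V (p + 1))) rpredB.
exists (U, W, T); apply: vertex_inj => i; rewrite vertex_glue.
case: (posnP i) => [->|i0]; first by rewrite glue_vertex0 vertex0.
case: (leqP i p) => [lei|ltpi].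
  by rewrite glue_vertex_left ?i0 // UE TE ltn_size_path i0 lei mulr1n subrK.
have [j j0 ->] : exists2 j, (0 < j)%N & i = (p + j)%N.
  by exists (i - p)%N; rewrite ?subn_gt0 ?subnKC // ltnW.
case: (leqP j r) => [lej|ltj].
  by rewrite glue_vertex_right ?j0 // WE TE ltn_size_path j0 lej mulr1n subrK.
by rewrite glue_vertex_ge ?ltn_add2l // vertex_ge ?size_concat // ltn_add2l.
Qed.

(** The correspondence is the graph of gluing.  If (V, U, W, T) is
    orthogonal to it, then V - glue (U, W, T) is orthogonal to all glued
    polygons.  So it is glued from some z0, whose components are in the
    radicals because gluing is isometric, and (U, W, T) + z0 is the required
    point of the graph. *)
Lemma concat_area_class :
  same_witt_class
    (osum (osum (area_form (path_lagrangian ab))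
                (oform (area_form (path_lagrangian a))))
          (oform (area_form (path_lagrangian b))))
    (area_form triangle_lagrangian).
Proof.
set q := osum _ _; set t := area_form _.
pose Z : vectType k := (subvs_of (polygon a) * subvs_of (polygon b)
                     * subvs_of (polygon triangle))%type.
pose f (z : Z) : form_support q := ((glue z, z.1.1), z.1.2).
pose h (z : Z) : form_support t := z.2.
have qE x y :
  q x y = area x.1.1 y.1.1 - area x.1.2 y.1.2 - area x.2 y.2 by [].
have tE x y : t x y = area x y by [].
have areaB s (x y v : subvs_of (polygon s)) :
    area (x - y) v = area x v - area y v.
  by rewrite addrC -scaleN1r area_linear scaleN1r addrC.
have areaD s (x y v : subvs_of (polygon s)) :
    area (x + y) v = area x v + area y v.
  by rewrite -[x]scale1r area_linear !scale1r.
apply: (@witt_correspondence k q t Z f h).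
- by move=> c x y; rewrite /f glue_linear.
- by [].
- move=> z z'; rewrite qE tE /f area_glue_glue /h /=.
  by rewrite -addrA -opprD addrC addKr.
move=> [[V U] W] T VUWT.
have perp z : area (V - glue (U, W, T)) (glue z) = 0.
  rewrite areaB area_glue_glue; have := VUWT z; rewrite qE tE /= => <-.
  by rewrite /h /=; ring.
have [z0 z0E] := glue_polar perp.
have rad z : area z0.1.1 z.1.1 + area z0.1.2 z.1.2 + area z0.2 z.2 = 0.
  by rewrite -area_glue_glue z0E perp.
have area0 s (x : subvs_of (polygon s)) : area x 0 = 0.
  rewrite /area big1 // => i _; rewrite !vertex_zero subrr; exact: linear0r.
have rad_a U' : area z0.1.1 U' = 0.
  by have := rad (U', 0, 0); rewrite !area0 !addr0.
have rad_b W' : area z0.1.2 W' = 0.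
  by have := rad (0, W', 0); rewrite !area0 !addr0 add0r.
have rad_t T' : area z0.2 T' = 0.
  by have := rad (0, 0, T'); rewrite !area0 !add0r.
exists ((U, W, T) + z0); split=> y; last first.
  by rewrite tE /h areaB areaD rad_t addr0 subrr.
have gluezE : glue ((U, W, T) + z0) = V.
  by rewrite -[(U, W, T)]scale1r glue_linear scale1r z0E addrC subrK.
rewrite qE /f gluezE /= !areaB !areaD rad_a rad_b.
by rewrite !addr0 !subrr.
Qed.

End Concatenation.
End Polygons.

Theorem proposition4p5 (k : fieldType) (hk : 2%N \notin [pchar k])
    (g : nat) (hg : (1 <= g)%N)
    (L0 L1 L2 : {vspace hyp k g})
    (hL0 : lagrangian L0) (hL1 : lagrangian L1) (hL2 : lagrangian L2)
    (a01 b01 : lag_path L0 L1) (a12 b12 : lag_path L1 L2) :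
  same_witt_class
    (osum (osum (sylvester (path_concat a01 a12)) (oform (sylvester a01)))
          (oform (sylvester a12)))
    (osum (osum (sylvester (path_concat b01 b12)) (oform (sylvester b01)))
          (oform (sylvester b12))).
Proof.
have class (a : lag_path L0 L1) (b : lag_path L1 L2) :
  same_witt_class
    (osum (osum (sylvester (path_concat a b)) (oform (sylvester a)))
          (oform (sylvester b)))
    (area_form (triangle_lagrangian hL0 hL1 hL2)).
  apply: witt_equiv_trans (concat_area_class hL0 hL1 hL2 a b).
  apply: same_witt_class_isometric; apply: isometric_sym.
  apply: isometric_osum; first apply: isometric_osum.
  - exact: area_form_sylvester.
  - exact/isometric_oform/area_form_sylvester.
  exact/isometric_oform/area_form_sylvester.
exact: witt_equiv_trans (class a01 a12) (witt_equiv_sym (class b01 b12)).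
Qed.
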